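(* Fix a constant $\delta > 0$. Consider the 3SUM-Indexing problem for input sets of size $n$ over either the cyclic group $([m], + \bmod m)$ with $m = O(n^{1+\delta})$, or the XOR group $(\{0,1\}^{(1+\delta)\log(n)+O(1)}, \oplus)$. Any (possibly adaptive) cell probe data structure solving this problem using $S$ memory cells (words) of $w = \Omega(\log n)$ bits each must have query time $T = \Omega(\log n / \log(Sw/n))$.
   Context: 3SUM-Indexing over a finite abelian group $(G,+)$: preprocess two sets $A_1, A_2 \subseteq G$, each of size $n$, into a data structure consisting of $S$ memory cells of $w$ bits each, so that given any query element $z \in G$ one can decide whether there exist $a_1 \in A_1$, $a_2 \in A_2$ with $a_1 + a_2 = z$. In the cell probe model, the only cost of a query is the number of memory cells accessed (probed); the query time $T$ is the maximum number of cells probed on any query. Cells to probe may be chosen adaptively, i.e. depending on the query and the contents of previously probed cells. $[m] = \{0,1,\dots,m-1\}$ with addition modulo $m$; $\{0,1\}^k$ with bitwise XOR. The bounds are asymptotic in $n$.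
   Formalization: The bound is proved for w ≤ (log n + Sw/n)^K, K any constant (automatic if S ≥ n or w is polylogarithmic); without this, S = 1 and w = Θ(n log n) give T = 1, refuting it. Also m = O(n^{1+δ}) is read as m = Θ(n^{1+δ}). *)

(* Defs.v *)
From HB Require Import structures.
From mathcomp Require Import all_boot all_order all_algebra.
From mathcomp Require Import reals exp.
Set Implicit Arguments.
Unset Strict Implicit.
Unset Printing Implicit Defensive.
Import Order.TTheory GRing.Theory Num.Theory.
Local Open Scope ring_scope.

Definition memory (S w : nat) := S.-tuple (w.-tuple bool).

(* An adaptive query algorithm: the continuation of [Probe i] receives the
   contents of cell [i], so later probes may depend on it. *)
Inductive probe_tree (S w : nat) : Type :=
| Answer of bool
| Probe (i : 'I_S) of (w.-tuple bool -> probe_tree S w).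
Arguments Answer {S w}.

Fixpoint run (S w : nat) (t : probe_tree S w) (M : memory S w) : bool :=
  match t with
  | Answer b => b
  | Probe i k => run (k (tnth M i)) M
  end.

Fixpoint probes (S w : nat) (t : probe_tree S w) (M : memory S w) : nat :=
  match t with
  | Answer _ => 0%N
  | Probe i k => (probes (k (tnth M i)) M).+1
  end.

Record cell_probe_ds (S w : nat) (G : finZmodType) := CellProbeDS {
  preprocess : {set G} -> {set G} -> memory S w;
  query : G -> probe_tree S w
}.

Definition in_sumset (G : finZmodType) (A1 A2 : {set G}) (z : G) : bool :=
  [exists a1 in A1, exists a2 in A2, a1 + a2 == z].

Definition solves_3sum_indexing (n S w : nat) (G : finZmodType)
    (D : cell_probe_ds S w G) : Prop :=
  forall A1 A2 : {set G}, #|A1| = n -> #|A2| = n ->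
  forall z : G, run (query D z) (preprocess D A1 A2) = in_sumset A1 A2 z.

Definition query_time (n S w : nat) (G : finZmodType)
    (D : cell_probe_ds S w G) : nat :=
  (\max_(A : {set G} * {set G} | (#|A.1| == n) && (#|A.2| == n))
    \max_(z : G) probes (query D z) (preprocess D A.1 A.2))%N.

Definition log2 (R : realType) (x : R) : R := ln x / ln 2.

(* The upper bound on [w] says that [w] is at most polynomial in
   [log n + S w / n]; it holds with [K = 1] as soon as [S >= n], and for every
   [S] when [w <= (log n) ^ K].  Without it the bound fails: a single cell of
   [O(n log n)] bits ([S = 1]) holds the whole input, so one probe answers every
   query although [log (S w / n) = O(log log n)].  Any correct [D] has
   [S w >> n] for large [n], so the quotient of logarithms is then positive. *)
Definition indexing_lower_bound (R : realType) (c cw : R) (K n : nat)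
    (G : finZmodType) : Prop :=
  forall (S w : nat) (D : cell_probe_ds S w G),
    solves_3sum_indexing n D ->
    cw * log2 (n%:R : R) <= w%:R ->
    w%:R <= (log2 (n%:R : R) + S%:R * w%:R / n%:R) ^+ K ->
    c * (log2 (n%:R : R) / log2 (S%:R * w%:R / n%:R : R)) <= (query_time n D)%:R.

(* Main.v *)
Require Import Defs.
From mathcomp Require Import all_boot all_order all_algebra.
From mathcomp Require Import reals exp.
From mathcomp Require Import fingroup perm zify lra.
Import Order.TTheory GRing.Theory Num.Theory.
Set Implicit Arguments.
Unset Strict Implicit.
Unset Printing Implicit Defensive.

(* Each query of the 3SUM instance is turned into an end pair [v = (s, t, e)] of
   a path in [2 ^ e] copies of a butterfly of depth [d] and degree
   [B = 2 ^ (8 k)]: the [i]-th edge of the path is determined by [t_0 .. t_i]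
   and [s_i .. s_(d-1)].  [A1] holds, for each level [i], the partial vectors
   made of the remaining coordinates, and [A2] holds an arbitrary set [Y] of
   edges; by adding coordinates, [v] is a sum iff one of its edges is in [Y].

   Any choice of a permutation of the [B] digits at each group of each level
   gives as many edge-disjoint paths as there are sources; there are at least
   [B ^ (N / 2)] such choices, where [N] is the total number of path edges.
   When all these paths avoid [Y], the set of cells probed by their queries,
   together with the contents of these cells, certifies it.  For a given [Y]
   there are few possible sets of cells, so some certificate is valid for a large
   fraction of all choices; the union of the corresponding paths has at least
   [N B ^ (1 / 4)] edges, all of which avoid [Y].  If [d > 18 T] there are not
   enough certificates to cover all sets [Y] in this way. *)

Local Open Scope nat_scope.

(** * Counting estimates for factorials and small sets *)

Lemma card_set_of (T : finType) : #|{: {set T}}| = 2 ^ #|T|.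
Proof. by rewrite -[#|T|]cardsT -card_powerset powersetT cardsT. Qed.

(** Factor [i + 1] of one copy of [n!] is paired with factor [n - i] of the other; each such product
    is at least [n]. *)
Lemma fact_sqr_lower n : n ^ n <= n`! ^ 2.
Proof.
have e1 : n`! = \prod_(0 <= i < n) i.+1 by rewrite fact_prod big_add1.
have e2 : n`! = \prod_(0 <= i < n) (n - i).
  by rewrite e1 big_nat_rev /=; apply: eq_big_nat => i /andP[_ lt_in]; lia.
rewrite expnS expn1 {1}e1 e2 -big_split /=.
rewrite -[n in n ^ _ <= _](addn0 n) -[X in _ ^ X](subn0 n) -prod_nat_const_nat.
rewrite big_nat [leqRHS]big_nat.
by apply: leq_prod => i /andP[_ lt_in]; nia.
Qed.

(** In quotient form, [(1 + 1/R)^j <= 1 + 2j/R]. The induction step needs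
    [(R + 1)(R + 2j) <= R(R + 2j + 2)], which is exactly [2j <= R]. *)
Lemma expnS_leq_linear R j : 2 * j <= R -> R.+1 ^ j * R <= R ^ j * (R + 2 * j).
Proof.
elim: j => [|j IH] le_jR; first by rewrite !expn0 !mul1n; lia.
have {}IH := IH ltac:(lia).
rewrite !expnS; set A := R.+1 ^ j in IH *; set B := R ^ j in IH *.
have h1 : R.+1 * (A * R) <= R.+1 * (B * (R + 2 * j)) by rewrite leq_mul2l IH orbT.
have h2 : B * (R.+1 * (R + 2 * j)) <= B * (R * (R + 2 * j.+1)).
  by rewrite leq_mul2l; apply/orP; right; nia.
by move: h1 h2; lia.
Qed.

(** The linear bound with base [2R] and exponent [R] gives [(1 + 1/(2R))^R <= 2], which is then
    squared. *)
Lemma expnS_leq4 R : 0 < R -> (2 * R).+1 ^ (2 * R) <= 4 * (2 * R) ^ (2 * R).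
Proof.
move=> R_gt0; have h := @expnS_leq_linear (2 * R) R (leqnn _).
have {}h : (2 * R).+1 ^ R <= 2 * (2 * R) ^ R.
  rewrite -(leq_pmul2r (m := 2 * R)); last by lia.
  by apply: leq_trans h _; rewrite mulnDr; lia.
by rewrite [X in _ ^ X <= _ * _ ^ X]mulnC !expnM -[4]/(2 ^ 2) -expnMn leq_exp2r.
Qed.

Lemma card_small_sets (T : finType) m :
  #|[set C : {set T} | #|C| <= m]| = \sum_(i < m.+1) 'C(#|T|, i).
Proof.
rewrite -sum1_card (partition_big (fun C : {set T} => inord #|C| : 'I_m.+1) predT) //=.
apply: eq_bigr => i _; rewrite -card_draws -sum1_card; apply: eq_bigl => C.
rewrite !inE -val_eqE /=; have [le_Cm|lt_mC] := leqP #|C| m; first by rewrite inordK.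
by apply/esym/negbTE; have := ltn_ord i; lia.
Qed.

(* Weighting a set [C] by [R ^ - #|C|] with [R = 2 ^ r] sums to
   [(1 + 1 / R) ^ S <= 4 ^ (S / R)]. *)
Lemma card_small_sets_bound (T : finType) r n m :
  0 < r -> n <= m -> #|T| <= 2 ^ r * n ->
  #|[set C : {set T} | #|C| <= m]| <= 2 ^ ((r + 2) * m).
Proof.
move=> r_gt0 le_nm; set S := #|T| => le_S.
have [le_Sm|/ltnW le_mS] := leqP S m.
  apply: leq_trans (max_card _) _; rewrite card_set_of leq_exp2l //.
  by apply: leq_trans le_Sm _; rewrite leq_pmull // addn2.
have R_gt0 : 0 < 2 ^ r by rewrite expn_gt0.
have eR : 2 ^ r = 2 * 2 ^ r.-1 by rewrite -expnS prednK.
rewrite card_small_sets -(leq_pmul2r (m := (2 ^ r) ^ (S - m))) ?expn_gt0 ?R_gt0 //.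
apply: (@leq_trans ((2 ^ r).+1 ^ S)).
  rewrite -(addn1 (2 ^ r)) expnDn big_distrl /=.
  have le_mS1 : m.+1 <= S.+1 by [].
  rewrite (big_ord_widen _ (fun i => 'C(#|T|, i) * (2 ^ r) ^ (S - m)) le_mS1).
  rewrite big_mkcond; apply: leq_sum => i _; case: ifP => // lt_im.
  by rewrite exp1n muln1 leq_mul2l leq_pexp2l ?orbT //; lia.
(* The exponent [S] is raised to the multiple [2 ^ r * n], so that [expnS_leq4] applies to [n] equal
   blocks. *)
rewrite -(leq_pmul2r (m := (2 ^ r) ^ (2 ^ r * n - S))) ?expn_gt0 ?R_gt0 //.
apply: (@leq_trans ((2 ^ r).+1 ^ (2 ^ r * n))).
  rewrite -{2}(subnKC le_S) expnD leq_mul2l; apply/orP; right.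
  by have [->|h] := posnP (2 ^ r * n - S); rewrite ?expn0 // leq_exp2r.
apply: (@leq_trans (4 ^ n * (2 ^ r) ^ (2 ^ r * n))).
  rewrite !expnM -expnMn; have [->|n_gt0] := posnP n; first by rewrite !expn0.
  by rewrite leq_exp2r // eR expnS_leq4 // expn_gt0.
have -> : (2 ^ r) ^ (2 ^ r * n) = (2 ^ r) ^ m * (2 ^ r) ^ (S - m) * (2 ^ r) ^ (2 ^ r * n - S).
  by rewrite -!expnD subnKC // subnKC.
rewrite !mulnA !leq_mul2r -[4]/(2 ^ 2) -!expnM -expnD leq_exp2l //.
by rewrite mulnDl [r * m + _]addnC leq_add2r leq_mul2l le_nm !orbT.
Qed.

(** * Probed cells and certificates *)

Fixpoint probed S w (t : probe_tree S w) (M : memory S w) : {set 'I_S} :=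
  match t with
  | Answer _ => set0
  | Probe i k => i |: probed (k (tnth M i)) M
  end.

Lemma card_probed S w (t : probe_tree S w) M : #|probed t M| <= probes t M.
Proof.
elim: t => [b|i k IH] /=; first by rewrite cards0.
by rewrite cardsU1; apply: (@leq_add _ _ 1); rewrite ?leq_b1.
Qed.

Lemma probed_local S w (t : probe_tree S w) (M M' : memory S w) (C : {set 'I_S}) :
  {in C, tnth M =1 tnth M'} -> probed t M \subset C ->
  probed t M' = probed t M /\ run t M' = run t M.
Proof.
move=> eqM; elim: t => [b|i k IH] //=; rewrite subUset sub1set => /andP[iC sC].
by rewrite -(eqM i iC); case: (IH _ sC) => -> ->.
Qed.

Definition graph (J X : finType) (c : {ffun J -> X}) : {set J * X} :=
  [set e | c e.1 == e.2].

Lemma card_graph (J X : finType) (c : {ffun J -> X}) : #|graph c| = #|J|.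
Proof.
rewrite -(card_imset predT (f := fun j => (j, c j))); last by move=> j1 j2 [].
apply: eq_card => -[j x]; rewrite inE /=; apply/eqP/imsetP => [<-|[j' _ [-> ->]] //].
by exists j.
Qed.

(** The number of such [c] is the product of the fibre sizes of [U] over [J], whose average is at
    most [2 ^ h]. *)
Lemma card_graph_sub (J X : finType) (U : {set J * X}) h :
  #|U| <= #|J| * 2 ^ h ->
  #|[set c | graph c \subset U]| <= 2 ^ (h.+1 * #|J|).
Proof.
move=> le_U; pose deg j := #|[pred x | (j, x) \in U]|.
have h_gt0 : 0 < 2 ^ h by rewrite expn_gt0.
have sum_deg : \sum_j deg j = #|U|.
  under eq_bigr do rewrite /deg -sum1_card; rewrite pair_big_dep /= sum1_card.
  by apply: eq_card => -[j x].
have -> : #|[set c | graph c \subset U]| = \prod_j deg j.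
  transitivity #|family (fun j => [pred x | (j, x) \in U])|.
    apply: eq_card => c; rewrite inE; apply/subsetP/familyP => [sU j | fU [j x]].
      by rewrite inE; apply: sU; rewrite inE.
    by rewrite inE /= => /eqP <-; have := fU j; rewrite inE.
  by rewrite card_family foldrE big_map big_enum.
(* An integral substitute for the inequality of means: with [q = deg j %/ 2 ^ h] one has
   [deg j < (q + 1) 2 ^ h <= 2 ^ (h + q)], and the [q] add up to at most [#|J|]. *)
apply: (@leq_trans (\prod_j 2 ^ (h + deg j %/ 2 ^ h))).
  apply: leq_prod => j _; rewrite expnD; have := ltn_ceil (deg j) h_gt0.
  have := ltn_expl (deg j %/ 2 ^ h) (isT : 1 < 2).
  set q := deg j %/ 2 ^ h; move: (2 ^ h) (deg j) (2 ^ q) => *; nia.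
rewrite -expn_sum leq_exp2l // big_split /= sum_nat_const mulSn addnC mulnC leq_add2r.
rewrite -(leq_pmul2r h_gt0) big_distrl /= (leq_trans _ le_U) // -sum_deg.
by apply: leq_sum => j _; apply: leq_trunc_div.
Qed.

Lemma leq_card_bigcup (I T : finType) (P : {pred I}) (A : I -> {set T}) :
  #|\bigcup_(i in P) A i| <= \sum_(i in P) #|A i|.
Proof.
elim/big_rec2: _ => [|i n B _ le_Bn]; first by rewrite cards0.
by rewrite (leq_trans (leq_card_setU _ _)) // leq_add2l.
Qed.

(** The [good] sets [Y] are counted in two ways. They form a fraction at least [2 ^ -(#|J| + 1)] of
    all [Y]; on the other hand each avoids the large set [U p] of one of at most [2 ^ (a + w * m)]
    certificates [p]. *)
Lemma certificate_bound S w T n' a h (J X V : finType)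
    (F : {set {ffun J -> X}}) (Q : {ffun J -> X} -> {set V})
    (tr : V -> probe_tree S w) (mem : {set J * X} -> memory S w) :
  (forall c, c \in F -> #|Q c| <= n') ->
  (forall Y c, c \in F ->
     [forall v in Q c, ~~ run (tr v) (mem Y)] = [disjoint graph c & Y]) ->
  (forall Y v, probes (tr v) (mem Y) <= T) ->
  #|[set C : {set 'I_S} | #|C| <= n' * T]| <= 2 ^ a ->
  2 ^ (a + #|J|.+1 + h.+1 * #|J|) < #|F| ->
  #|J| * 2 ^ h <= a + w * (n' * T) + #|J|.+1.
Proof.
move=> cardQ Qdisj le_T; set m := n' * T => card_C ltF.
(* Cells outside a certificate get the default [y0], so a set [C] of cells carries only
   [2 ^ (w * #|C|)] different contents. *)
pose y0 : w.-tuple bool := nseq_tuple w false.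
pose content (f : {ffun 'I_S -> w.-tuple bool}) : memory S w := [tuple f i | i < S].
pose Xc (C : {set 'I_S}) (M : memory S w) :=
  [set c in F | [forall v in Q c, (probed (tr v) M \subset C) && ~~ run (tr v) M]].
pose U (p : {set 'I_S} * {ffun 'I_S -> w.-tuple bool}) :=
  \bigcup_(c in Xc p.1 (content p.2)) graph c.
pose Dis (Y : {set J * X}) := [set c in F | [disjoint graph c & Y]].
pose certs := [set p : {set 'I_S} * {ffun 'I_S -> w.-tuple bool} |
  [&& #|p.1| <= m, p.2 \in pffun_on y0 p.1 predT & #|J| * 2 ^ h < #|U p|]].
pose good := [set Y | #|F| <= #|Dis Y| * 2 ^ #|J|.+1].
pose NB := #|{: J * X}|.
have le_NB : #|J| <= NB.
  have [c _] : exists c, c \in F by apply/card_gt0P; apply: leq_trans ltF.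
  by rewrite -(card_graph c) max_card.
have F_gt0 : 0 < #|F| by apply: leq_trans ltF.
(* Averaging: each [c] is disjoint from [2 ^ (NB - #|J|)] of the sets [Y], and the sets that are not
   good contribute at most half of that total. *)
have good_large : 2 ^ NB <= #|good| * 2 ^ #|J|.+1.
  have sum_Dis : \sum_Y #|Dis Y| = #|F| * 2 ^ (NB - #|J|).
    under eq_bigr do rewrite -sum1_card.
    rewrite (exchange_big_dep (fun c => c \in F)) /=; last first.
      by move=> Y c _; rewrite inE => /andP[].
    rewrite -sum_nat_const; apply: eq_bigr => c cF.
    rewrite sum1_card -(card_graph c) -[graph c in RHS]setCK -cardsCs -card_powerset.
    apply: eq_card => Y; transitivity (c \in Dis Y) => //.
    by rewrite inE cF powersetE /= disjoint_sym disjoints_subset.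
  rewrite -(leq_pmul2l F_gt0).
  have: \sum_Y #|Dis Y| * 2 ^ #|J|.+1 <=
        \sum_(Y : {set J * X}) ((Y \in good) * (#|F| * 2 ^ #|J|.+1) + #|F|).
    apply: leq_sum => Y _; rewrite inE; case: (leqP #|F|) => [_|lt_F]; last exact: ltnW.
    rewrite mul1n (leq_trans _ (leq_addr _ _)) // leq_mul2r subset_leq_card ?orbT //.
    by apply/subsetP => c; rewrite inE => /andP[].
  rewrite -big_distrl sum_Dis big_split /= -big_distrl /= sum_nat_const.
  have -> : \sum_(Y : {set J * X}) (Y \in good : nat) = #|good|.
    by rewrite -sum1_card [RHS]big_mkcond; apply: eq_bigr => Y _; case: ifP.
  rewrite card_set_of.
  rewrite -/NB -mulnA -expnD addnS subnK // expnS.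
  by move: (2 ^ NB) (2 ^ _) #|F| #|good| => *; nia.
have good_cover : good \subset \bigcup_(p in certs) [set Y : {set J * X} | Y \subset ~: U p].
  apply/subsetP => Y; rewrite inE => goodY.
  have Dis_gt0 : 0 < #|Dis Y| by move: goodY; case: #|Dis Y| => //; lia.
  have le_Dis : #|Dis Y| <= \sum_(C : {set 'I_S} | #|C| <= m) #|Xc C (mem Y)|.
    apply: leq_trans (leq_card_bigcup _ _); apply/subset_leq_card/subsetP => c.
    rewrite inE => /andP[cF cY]; have Qc := Qdisj Y c cF; rewrite cY in Qc.
    apply/bigcupP; exists (\bigcup_(v in Q c) probed (tr v) (mem Y)).
      apply: leq_trans (leq_card_bigcup _ _) _.
      apply: (@leq_trans (\sum_(v in Q c) T)).
        by apply: leq_sum => v _; apply: leq_trans (card_probed _ _) (le_T _ _).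
      by rewrite sum_nat_const leq_mul2r cardQ ?orbT.
    rewrite inE cF; apply/forall_inP => v vQ; rewrite (forall_inP Qc) // andbT.
    exact: bigcup_sup vQ.
  (* Pigeonhole: at most [2 ^ a] sets of cells share the members of [Dis Y]. *)
  have [C le_Cm le_DisC] : exists2 C : {set 'I_S}, #|C| <= m & #|Dis Y| <= 2 ^ a * #|Xc C (mem Y)|.
    have [/exists_inP[C le_C le_X]|] :=
      boolP [exists (C : {set 'I_S} | #|C| <= m), #|Dis Y| <= 2 ^ a * #|Xc C (mem Y)|].
      by exists C.
    rewrite negb_exists_in => /forall_inP ltX.
    have: \sum_(C : {set 'I_S} | #|C| <= m) (2 ^ a * #|Xc C (mem Y)|).+1 <=
          \sum_(C : {set 'I_S} | #|C| <= m) #|Dis Y|.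
      by apply: leq_sum => C /ltX; rewrite -ltnNge.
    under eq_bigr do rewrite -addn1.
    rewrite big_split /= -big_distrr /= sum1_card sum_nat_const.
    move: card_C le_Dis; rewrite cardsE; move: (\sum_(C : {set _} | _) _) => s.
    have: 0 < 2 ^ a by rewrite expn_gt0.
    move: #|_| (2 ^ a) (#|Dis Y|) Dis_gt0 => c1 c2 c3 c3_gt0 c2_gt0 le_c le_s le_cs.
    have: c1 * c3 <= c2 * s by apply: leq_mul.
    by have [|s_gt0 ?] := posnP s; nia.
  pose f := [ffun i => if i \in C then tnth (mem Y) i else y0].
  have agree : {in C, tnth (content f) =1 tnth (mem Y)}.
    by move=> i iC; rewrite tnth_mktuple ffunE iC.
  have agree' : {in C, tnth (mem Y) =1 tnth (content f)} by move=> i /agree.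
  have eqX : Xc C (content f) = Xc C (mem Y).
    apply/setP => c; rewrite !inE; congr (_ && _); apply: eq_forallb => v.
    congr (_ ==> _); apply/andP/andP => -[sC].
      by have [-> ->] := probed_local agree sC.
    by have [-> ->] := probed_local agree' sC.
  apply/bigcupP; exists (C, f).
    rewrite inE /= le_Cm /=; apply/andP; split.
      apply/pffun_onP; split=> //; apply/subsetP => i; rewrite !inE ffunE.
      by case: ifP => //; rewrite eqxx.
    (* Were [U] small, [card_graph_sub] would leave too few [c] in [Xc], against the assumed size of
       [F]. *)
    rewrite ltnNge; apply/negP => /card_graph_sub le_U; move: ltF; apply/negP; rewrite -leqNgt.
    apply: leq_trans goodY _; rewrite addnAC expnD leq_mul2r expnD; apply/orP; right.
    apply: leq_trans le_DisC _; rewrite leq_mul2l; apply/orP; right.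
    apply: leq_trans le_U; rewrite -eqX; apply/subset_leq_card/subsetP => c cX.
    by rewrite inE; apply: bigcup_sup cX.
  rewrite inE -disjoints_subset bigcup_disjoint // => c.
  rewrite /= eqX inE => /andP[cF /forall_inP cX]; rewrite disjoint_sym -Qdisj //.
  by apply/forall_inP => v /cX /andP[].
have certs_small : #|certs| <= 2 ^ a * 2 ^ (w * m).
  pose small := [set C : {set 'I_S} | #|C| <= m].
  apply: (@leq_trans (\sum_(C in small) \sum_(f in pffun_on y0 C predT) 1)).
    rewrite pair_big_dep /= sum1_card; apply/subset_leq_card/subsetP => p.
    by rewrite inE => /and3P[p1m p2C _]; apply/andP; rewrite inE.
  apply: (@leq_trans (\sum_(C in small) 2 ^ (w * m))); last first.
    by rewrite sum_nat_const leq_mul2r card_C orbT.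
  apply: leq_sum => C; rewrite inE => le_C; rewrite sum1_card card_pffun_on.
  by rewrite card_tuple card_bool -expnM leq_exp2l // leq_mul2l le_C orbT.
have le_good : #|good| * 2 ^ (#|J| * 2 ^ h) <= #|certs| * 2 ^ NB.
  have le_cup := leq_trans (subset_leq_card good_cover) (leq_card_bigcup _ _).
  apply: leq_trans (leq_mul le_cup (leqnn _)) _.
  rewrite big_distrl -sum_nat_const /=; apply: leq_sum => p; rewrite inE => /and3P[_ _ ltU].
  rewrite -/(powerset _) card_powerset -expnD leq_exp2l // /NB -(cardsC (U p)) addnC.
  by rewrite leq_add2r ltnW.
rewrite -(leq_exp2l (m := 2)) // !expnD -(leq_pmul2r (m := 2 ^ NB)) ?expn_gt0 //.
move: good_large le_good certs_small; move: (2 ^ NB) (2 ^ (#|J| * 2 ^ h)) (2 ^ a) => x y z.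
move: (2 ^ (w * m)) (2 ^ #|J|.+1) #|good| #|certs| => t u g k h1 h2 h3.
apply: (@leq_trans (y * (g * u))); first by rewrite leq_mul2l h1 orbT.
apply: (@leq_trans (k * x * u)); first by rewrite mulnA leq_mul2r [y * g]mulnC h2 orbT.
apply: (@leq_trans (z * t * x * u)); first by rewrite !leq_mul2r h3 !orbT.
by rewrite mulnAC.
Qed.

(** * Edge-disjoint paths in the butterfly *)

Section Butterfly.
Context {d : nat} {X E : finType}.

Definition state : finType := ({ffun 'I_d -> X} * E)%type.
Definition arc : finType := ('I_d * state * X)%type.
Definition ends : finType := ({ffun 'I_d -> X} * {ffun 'I_d -> X} * E)%type.

(* The state of a walk from [s] to [t] after [i] steps, step [j] having
   overwritten coordinate [j] of [s] by that of [t]. *)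
Definition mix (i : nat) (v : ends) : state :=
  ([ffun k : 'I_d => if k < i then v.1.2 k else v.1.1 k], v.2).

Definition edge (i : 'I_d) (v : ends) : arc := (i, mix i v, v.1.2 i).

Definition step (c : {ffun 'I_d * state -> X}) (i : 'I_d) (u : state) : state :=
  ([ffun k => if k == i then c (i, u) else u.1 k], u.2).

(** Since [step c i] changes only coordinate [i], injectivity says that [c] permutes the digits [X]
    for each fixed choice of level and other coordinates. *)
Definition matchings : {set {ffun 'I_d * state -> X}} :=
  [set c | [forall i, injectiveb (step c i)]].

Definition routes (c : {ffun 'I_d * state -> X}) : {set ends} :=
  [set v | [forall i, edge i v \in graph c]].

(** A route is determined by its source: [c] applied to the current state yields the next coordinate
    of the target. *)
Lemma card_routes c : #|routes c| <= #|X| ^ d * #|E|.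
Proof.
pose src (v : ends) : state := (v.1.1, v.2).
have inj_src : {in routes c &, injective src}.
  move=> [[s t] e] [[s' t'] e']; rewrite !inE => /forallP vc /forallP v'c [eqs eqe].
  rewrite -{}eqs -{}eqe in v'c *.
  suff eqt j : forall i : 'I_d, i < j -> t i = t' i.
    by congr (_, _, _); apply/ffunP => i; apply: eqt (ltn_ord i).
  elim: j => // j IH i le_ij.
  have := vc i; have := v'c i; rewrite !inE /= => /eqP <- /eqP <-.
  congr (c (_, (_, _))); apply/ffunP => k; rewrite !ffunE /=; case: ifP => // lt_ki.
  by apply: IH; lia.
rewrite -(card_in_imset inj_src) (leq_trans (max_card _)) //.
by rewrite card_prod card_ffun card_ord.
Qed.

Fixpoint walk c j (u : state) : state :=
  if j is j'.+1 then
    if insub j' is Some i then step c i (walk c j' u) else walk c j' u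
  else u.

Lemma walk_inj c j : c \in matchings -> injective (walk c j).
Proof.
rewrite inE => /forallP cP; elim: j => [|j IH] u v //=; case: insubP => [i _ _|_].
  by move/injectiveP: (cP i) => inj /inj /IH.
by move/IH.
Qed.

Lemma walkS c (i : 'I_d) u : walk c i.+1 u = step c i (walk c i u).
Proof. by rewrite /= valK. Qed.

Lemma walk2 c j u : (walk c j u).2 = u.2.
Proof. by elim: j => //= j IH; case: insubP. Qed.

Lemma walk_ge c j u (k : 'I_d) : j <= k -> (walk c j u).1 k = u.1 k.
Proof.
elim: j => //= j IH lt_jk; case: insubP => [i _ ij|_]; last by rewrite IH // ltnW.
by rewrite ffunE -val_eqE /= ij gtn_eqF // IH // ltnW.
Qed.

Lemma walk_lt c j u (k : 'I_d) : k < j -> (walk c j u).1 k = (walk c k.+1 u).1 k.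
Proof.
elim: j => // j IH; rewrite ltnS leq_eqVlt => /orP[/eqP -> //|lt_kj].
rewrite -(IH lt_kj) /=; case: insubP => [i _ ij|//].
by rewrite ffunE -val_eqE /= ij ltn_eqF.
Qed.

(** An injective walk on a finite set is bijective, so [u] can be traced back to a source, and
    walking on from there gives the target. *)
Lemma routes_cover c (i : 'I_d) u :
  c \in matchings -> exists2 v, v \in routes c & mix i v = u.
Proof.
move=> cM; have [g _ gK] := injF_bij (walk_inj (j := i) cM).
pose u0 := g u; pose v : ends := (u0.1, (walk c d u0).1, u0.2).
have mixE j : j <= d -> mix j v = walk c j u0.
  move=> le_jd; rewrite [RHS]surjective_pairing walk2 /mix /=; congr (_, _).
  apply/ffunP => k; rewrite ffunE; case: ltnP => [lt_kj|le_jk]; last by rewrite walk_ge.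
  by rewrite walk_lt // [RHS]walk_lt.
exists v; last by rewrite mixE ?gK // ltnW.
rewrite inE; apply/forallP => j; rewrite inE /= mixE; last exact: ltnW.
by rewrite walk_lt // walkS ffunE eqxx.
Qed.

(** By [routes_cover] the edges of the routes fill the whole graph of [c]. This supplies the
    hypothesis on [Q] in [certificate_bound]. *)
Lemma routes_disjoint c (Y : {set arc}) : c \in matchings ->
  [forall v in routes c, ~~ [exists i, edge i v \in Y]] = [disjoint graph c & Y].
Proof.
move=> cM; apply/forall_inP/pred0P => [free [[i u] x] /= | free v vc].
  apply/negbTE/negP => /andP[]; rewrite inE => /eqP /= <- uY.
  have [v vc mixv] := routes_cover i u cM.
  case/negP: (free v vc); apply/existsP; exists i.
  move: vc; rewrite inE => /forallP /(_ i); rewrite inE /edge /= mixv => /eqP <- //.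
rewrite negb_exists; apply/forallP => i; apply: contraFN (free (edge i v)) => /= ->.
by move: vc; rewrite inE => /forallP ->.
Qed.

End Butterfly.
Arguments state : clear implicits.
Arguments arc : clear implicits.
Arguments ends : clear implicits.
Arguments matchings : clear implicits.

(** An independent permutation of [X] for each level and each value of the other coordinates gives a
    matching; [fact_sqr_lower] bounds the number of these choices. *)
Lemma card_matchings d (X E : finType) :
  #|X| ^ #|{: 'I_d * state d X E}| <= #|matchings d X E| ^ 2.
Proof.
case: d => [|d].
  have d0 : #|{: 'I_0 * state 0 X E}| = 0 by rewrite card_prod card_ord.
  rewrite d0 expn0 sqrn_gt0; apply/card_gt0P.
  by exists (ffun0 d0); rewrite inE; apply/forallP => -[].
pose grp : finType := ({ffun 'I_d -> X} * E)%type.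
pose del (i : 'I_d.+1) (u : state d.+1 X E) : grp := ([ffun k => u.1 (lift i k)], u.2).
pose ins (i : 'I_d.+1) (g : grp) (x : X) : state d.+1 X E :=
  ([ffun k => if unlift i k is Some k' then g.1 k' else x], g.2).
pose toc (p : {ffun 'I_d.+1 * grp -> {perm X}}) : {ffun 'I_d.+1 * state d.+1 X E -> X} :=
  [ffun a => p (a.1, del a.1 a.2) (a.2.1 a.1)].
have delK i g x : del i (ins i g x) = g.
  by rewrite [RHS]surjective_pairing; congr (_, _); apply/ffunP => k; rewrite !ffunE liftK.
have toc_inj : injective toc.
  move=> p q /ffunP eq_pq; apply/ffunP => -[i g]; apply/permP => x.
  by have := eq_pq (i, ins i g x); rewrite !ffunE /= unlift_none delK.
have toc_sub : toc @: predT \subset matchings d.+1 X E.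
  apply/subsetP => _ /imsetP[p _ ->]; rewrite inE; apply/forallP => i.
  apply/injectiveP => u u' [/ffunP eqs eqe].
  have eq_del : del i u = del i u'.
    congr (_, _) => //; apply/ffunP => k; have := eqs (lift i k).
    by rewrite !ffunE eq_sym (negbTE (neq_lift i k)).
  have eqi : u.1 i = u'.1 i.
    by have := eqs i; rewrite !ffunE eqxx /= eq_del => /perm_inj.
  rewrite (surjective_pairing u) (surjective_pairing u') eqe; congr (_, _).
  apply/ffunP => k; case: (unliftP i k) => [j|] -> //.
  by have [/ffunP/(_ j)] := eq_del; rewrite !ffunE.
have card_perm_all : #|{perm X}| = #|X|`!.
  rewrite -cardsT -card_perm; apply: eq_card => p; rewrite unfold_in.
  by apply/esym/subsetP => x; rewrite !inE.
apply: (@leq_trans ((#|X|`! ^ #|{: 'I_d.+1 * grp}|) ^ 2)); last first.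
  rewrite leq_sqr -card_perm_all -card_ffun -(card_imset predT toc_inj).
  exact: subset_leq_card.
have -> : #|{: 'I_d.+1 * state d.+1 X E}| = #|X| * #|{: 'I_d.+1 * grp}|.
  by rewrite !card_prod !card_ffun !card_ord expnS; lia.
have [->|grp_gt0] := posnP #|{: 'I_d.+1 * grp}|; first by rewrite muln0 !expn0.
by rewrite expnM [leqRHS]expnAC leq_exp2r // fact_sqr_lower.
Qed.

(** If the matchings outnumber the threshold of [certificate_bound] at [h = 2k], then [T < d] gives
    [2 ^ (2k) <= r + 5 + w], which is absurd. Otherwise [card_matchings] compares exponents and
    yields [(2k - 3) d <= (r + 3) T], where [r + 3 <= 18 (2k - 3)]. *)
Lemma butterfly_bound S w T d k r (X E : finType) (tr : ends d X E -> probe_tree S w)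
    (mem : {set arc d X E} -> memory S w) :
  #|X| = 2 ^ (8 * k) -> 0 < #|E| -> 6 < k -> 0 < d -> 0 < T ->
  w <= 2 ^ k -> r <= 16 * k -> S <= 2 ^ r * #|{: state d X E}| ->
  (forall Y v, run (tr v) (mem Y) = [exists i, edge i v \in Y]) ->
  (forall Y v, probes (tr v) (mem Y) <= T) ->
  d <= 18 * T.
Proof.
move=> cardX E_gt0 k_gt6 d_gt0 T_gt0 le_w le_r le_S tr_mem le_T.
have [|lt_Td] := leqP d T; first by lia.
pose N := #|{: state d X E}|; pose J := ('I_d * state d X E)%type.
have cardN : N = #|X| ^ d * #|E| by rewrite /N card_prod card_ffun card_ord.
have cardJ : #|{: J}| = d * N by rewrite card_prod card_ord.
have N_gt0 : 0 < N by rewrite cardN muln_gt0 E_gt0 expn_gt0 cardX expn_gt0.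
(* [r] may be zero whereas [card_small_sets_bound] wants a positive exponent, hence [r.+1]. *)
pose a := (r.+1 + 2) * (N * T).
have small : #|[set C : {set 'I_S} | #|C| <= N * T]| <= 2 ^ a.
  apply: (@card_small_sets_bound _ _ N) => //; first by rewrite leq_pmulr.
  by rewrite card_ord (leq_trans le_S) // leq_mul2r leq_exp2l // leqnSn orbT.
have [lt_F|le_F] := ltnP (2 ^ (a + #|{: J}|.+1 + (2 * k).+1 * #|{: J}|)) #|matchings d X E|.
  have cardR c : c \in matchings d X E -> #|routes c| <= N.
    by rewrite cardN card_routes.
  have free Y c : c \in matchings d X E ->
      [forall v in routes c, ~~ run (tr v) (mem Y)] = [disjoint graph c & Y].
    by move=> cM; rewrite -routes_disjoint //; apply: eq_forallb => v; rewrite tr_mem.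
  have := certificate_bound cardR free le_T small lt_F.
  rewrite cardJ mul2n -addnn expnD.
  have k_exp : 16 * k + 10 < 2 ^ k.
    elim: k k_gt6 {le_w le_r lt_F cardX} => // k IH; rewrite ltnS leq_eqVlt => /orP[/eqP <- //|].
    by move=> k_gt6; have := IH k_gt6; rewrite expnS; lia.
  rewrite /a; move: (2 ^ k) le_w k_exp => B le_w k_exp.
  move=> h; suff: B * B <= r + 5 + w by nia.
  rewrite -(leq_pmul2l d_gt0) -(leq_pmul2l N_gt0).
  apply: (@leq_trans ((r.+1 + 2) * (N * d) + w * (N * d) + N * d + N * d)); last by lia.
  rewrite mulnA [N * d]mulnC; apply: leq_trans h _.
  have le_NT : N * T <= d * N by rewrite mulnC leq_mul2r ltnW ?orbT.
  have : 0 < d * N by rewrite muln_gt0 d_gt0.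
  by move: (leq_mul (leqnn (r.+1 + 2)) le_NT) (leq_mul (leqnn w) le_NT); lia.
have : #|X| ^ #|{: J}| <= (2 ^ (a + #|{: J}|.+1 + (2 * k).+1 * #|{: J}|)) ^ 2.
  by rewrite (leq_trans (card_matchings d X E)) // leq_sqr.
rewrite cardX cardJ -!expnM leq_exp2l // /a => h.
suff: (2 * k - 3) * d <= (r + 3) * T by nia.
rewrite -(leq_pmul2l N_gt0); have : 0 < d * N by rewrite muln_gt0 d_gt0.
by move: h; nia.
Qed.

(** * Cubes in the group and the encoding by sumsets *)

Local Open Scope ring_scope.

(* For ['Z_m] the map [psi] reads a subset of [J] as a binary number, so that
   disjoint unions are sums without carry. *)
Definition cube_embeds (G : finZmodType) (J : finType) : Prop :=
  exists (psi : {set J} -> G) (D : {set G}),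
    [/\ injective psi,
        forall A B : {set J}, [disjoint A & B] -> psi (A :|: B) = psi A + psi B,
        (#|D| <= 4 * 2 ^ #|J|)%N
      & forall A B C : {set J}, psi C - psi A - psi B \in D].

(** Subtraction is XOR, so the range of [psi] is a subgroup and serves as [D]. *)
Lemma cube_embeds_bool (J : finType) k : (#|J| <= k)%N -> cube_embeds 'rV[bool]_k J.
Proof.
move=> le_Jk.
pose psi (A : {set J}) : 'rV[bool]_k :=
  \row_i (if insub (i : nat) is Some r then enum_val (r : 'I_#|J|) \in A else false).
have psi_sub A B C : psi C - psi A - psi B = psi [set j | (j \in C) (+) (j \in A) (+) (j \in B)].
  apply/rowP => i; rewrite !mxE; case: insubP => // r _ _.
  by rewrite inE.
exists psi, (psi @: setT); split=> [A B /rowP eqAB|A B dAB||A B C].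
- apply/setP => j; have := eqAB (widen_ord le_Jk (enum_rank j)); rewrite !mxE /=.
  by rewrite insubT //= => lt_j; rewrite (_ : Sub _ _ = enum_rank j) ?enum_rankK //; apply: val_inj.
- apply/rowP => i; rewrite !mxE; case: insubP => // r _ _; rewrite inE.
  have := disjointFr dAB (x := enum_val r).
  by case: (_ \in A) => //= ->.
- by rewrite (leq_trans (leq_imset_card _ _)) // cardsT card_set_of leq_pmull.
- by rewrite psi_sub imset_f.
Qed.

Definition bits (J : finType) (A : {set J}) (s : seq J) : nat :=
  foldr (fun j x => (j \in A) + 2 * x)%N 0%N s.

Lemma bits_lt (J : finType) (A : {set J}) s : (bits A s < 2 ^ size s)%N.
Proof. by elim: s => //= j s IH; rewrite expnS; case: (j \in A); lia. Qed.

Lemma bits_inj (J : finType) (A B : {set J}) s :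
  bits A s = bits B s -> {in s, A =i B}.
Proof.
elim: s => //= j s IH eqAB.
have [eqj eqs] : (j \in A) = (j \in B) /\ bits A s = bits B s.
  by move: eqAB; case: (j \in A); case: (j \in B); lia.
by move=> i; rewrite inE => /orP[/eqP -> // | /(IH eqs)].
Qed.

Lemma bitsU (J : finType) (A B : {set J}) s :
  [disjoint A & B] -> bits (A :|: B) s = (bits A s + bits B s)%N.
Proof.
move=> dAB; elim: s => //= j s ->; rewrite inE.
have := disjointFr dAB (x := j); case: (j \in A) => [->//|_]; lia.
Qed.

(** With [N = 2 ^ #|J|], the integers [psi C - psi A - psi B] lie strictly between [-2N] and [N];
    [D] is this interval, shifted by [2N] to be indexed by naturals. *)
Lemma cube_embeds_Zp (J : finType) m :
  (1 < m)%N -> (2 ^ #|J| <= m)%N -> cube_embeds 'Z_m J.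
Proof.
move=> m_gt1 le_Jm; set N := (2 ^ #|J|)%N in le_Jm *.
have lt_bits A : (bits A (enum J) < N)%N by rewrite /N cardE bits_lt.
exists (fun A => (bits A (enum J))%:R),
  [set i%:R - (2 * N)%:R | i : 'I_(3 * N)]; split=> [A B eqAB|A B dAB||A B C].
- have : bits A (enum J) = bits B (enum J).
    move/(congr1 (@nat_of_ord _)): eqAB; rewrite !val_Zp_nat //.
    by rewrite !modn_small // (leq_trans (lt_bits _)).
  by move/bits_inj => eqi; apply/setP => j; apply: eqi; rewrite mem_enum.
- by rewrite bitsU // natrD.
- by rewrite (leq_trans (leq_imset_card _ _)) // card_ord leq_mul2r orbT.
- have lt_i : (bits C (enum J) + (N - bits A (enum J)) + (N - bits B (enum J)) < 3 * N)%N.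
    by have := lt_bits C; have := lt_bits A; have := lt_bits B; lia.
  apply/imsetP; exists (Ordinal lt_i) => //=.
  have -> : (2 * N)%:R = N%:R + N%:R :> 'Z_m by rewrite mul2n -addnn natrD.
  rewrite !natrD !natrB ?(ltnW (lt_bits _)) //.
  by rewrite opprD addrACA [N%:R - _]addrC [N%:R - _]addrC !addrA !addrK.
Qed.

Definition fill (T : finType) n (A B : {set T}) : {set T} :=
  A :|: [set x in take (n - #|A|) (enum (B :\: A))].

Lemma card_fill (T : finType) n (A B : {set T}) :
  (#|A| <= n <= #|B|)%N -> #|fill n A B| = n.
Proof.
move=> /andP[le_An le_nB]; rewrite cardsU disjoint_setI0; last first.
  rewrite disjoint_sym disjoints_subset; apply/subsetP => x; rewrite inE => /mem_take.
  by rewrite mem_enum !inE => /andP[].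
rewrite cards0 subn0 cardsE (card_uniqP _) ?take_uniq ?enum_uniq // size_takel ?subnKC //.
rewrite -cardE cardsD; have := subset_leq_card (subsetIr B A); lia.
Qed.

Lemma fillP (T : finType) n (A B : {set T}) x :
  x \in fill n A B -> x \in A \/ x \in B.
Proof.
rewrite inE => /orP[xA|]; [by left | rewrite inE => /mem_take].
by rewrite mem_enum inE => /andP[_ xB]; right.
Qed.

(** Greedy choice: each earlier [s j] forbids only the elements of [s j + D] and [s j - D]. *)
Lemma separated_family (G : finZmodType) (D : {set G}) L :
  (2 * L * #|D| < #|G|)%N ->
  exists s : nat -> G, forall i j, (i < L)%N -> (j < L)%N -> s i - s j \in D -> i = j.
Proof.
elim: L => [|L IH] ltG; first by exists (fun=> 0).
have {}[|s sP] := IH; first by apply: leq_ltn_trans ltG; nia.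
pose bad := \bigcup_(j < L) ([set s j + x | x in D] :|: [set s j - x | x in D]).
have /card_gt0P[x] : (0 < #|~: bad|)%N.
  suff: (#|bad| < #|G|)%N by rewrite -(cardsC bad); lia.
  apply: leq_ltn_trans ltG; apply: leq_trans (leq_card_bigcup _ _) _.
  apply: (@leq_trans (\sum_(j < L) 2 * #|D|)).
    apply: leq_sum => j _; rewrite (leq_trans (leq_card_setU _ _)) // mul2n -addnn.
    by rewrite leq_add ?leq_imset_card.
  by rewrite sum_nat_const card_ord; nia.
rewrite inE => xbad; exists (fun i => if (i < L)%N then s i else x) => i j.
have out k (lt_kL : (k < L)%N) : (x - s k \in D) || (s k - x \in D) = false.
  apply: contraNF xbad => xk; apply/bigcupP; exists (Ordinal lt_kL) => //.
  rewrite inE; case/orP: xk => xD; apply/orP; [left|right]; apply/imsetP.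
    by exists (x - s k) => //=; rewrite addrC subrK.
  by exists (s k - x) => //=; rewrite opprB addrC subrK.
rewrite 2!ltnS (leq_eqVlt i) (leq_eqVlt j) => /orP[/eqP ->|lt_i] /orP[/eqP ->|lt_j] //.
- by rewrite ltnn lt_j => sD; have := out j lt_j; rewrite sD.
- by rewrite ltnn lt_i => sD; have := out i lt_i; rewrite sD orbT.
- by rewrite lt_i lt_j; apply: sP.
Qed.

(* Elements of [A1] and [A2] at level [i] are translated by [sg i] and [- sg i],
   where no two translates differ by an element of [D]: sums of different
   levels miss the range of [psi].  Two more translates of the cube supply the
   padding of [A1] and [A2] to exactly [n] elements. *)
Lemma sumset_gadget (G : finZmodType) (I J : finType) (W : I -> {set J}) n :
  cube_embeds G J ->
  (#|[set p : I * {set J} | p.2 \subset W p.1]| <= n <= 2 ^ #|J|)%N ->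
  (8 * (#|I| + 2) * 2 ^ #|J| < #|G|)%N ->
  exists (q : {set J} -> G) (A1 : {set G}) (A2 : {set I * {set J}} -> {set G}),
    #|A1| = n /\
    forall Y : {set I * {set J}}, (#|Y| <= n)%N ->
      (forall p, p \in Y -> [disjoint W p.1 & p.2]) ->
      #|A2 Y| = n /\
      forall C, in_sumset A1 (A2 Y) (q C) = [exists i, (i, C :\: W i) \in Y].
Proof.
move=> [psi [D [psi_inj psiU le_D psiD]]] /andP[le_Wn le_nJ] ltG.
have [|s sP] := @separated_family G D (#|I| + 2).
  by apply: leq_ltn_trans ltG; nia.
pose sg (i : I) := s (enum_rank i).
have sg_lt (i : I) : (enum_rank i < #|I| + 2)%N by rewrite ltn_addr.
pose t1 := s #|I|; pose t2 := s #|I|.+1.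
pose U := [set p : I * {set J} | p.2 \subset W p.1].
pose A1 := fill n [set sg p.1 + psi p.2 | p in U]
  [set t1 + psi A | A in setT].
pose A2 (Y : {set I * {set J}}) :=
  fill n [set psi p.2 - sg p.1 | p in Y] [set psi A - t2 | A in setT].
have shift_inj (f : G -> G) : injective f -> (n <= #|[set f (psi A) | A in [set: {set J}]]|)%N.
  by move=> fI; rewrite card_imset ?cardsT ?card_set_of //; apply: inj_comp fI psi_inj.
exists psi, A1, A2; split.
  rewrite card_fill // (leq_trans (leq_imset_card _ _) le_Wn) /=.
  exact: (shift_inj _ (addrI t1)).
move=> Y le_Yn disjY; split.
  rewrite card_fill // (leq_trans (leq_imset_card _ _) le_Yn) /=.
  exact: (shift_inj _ (addIr (- t2))).
(* A sum that falls in the range of [psi] forces [s i - s j] into [D], so both summands use the same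
   translate. *)
have clash A B C i j : (i < #|I| + 2)%N -> (j < #|I| + 2)%N ->
    s i + psi A + (psi B - s j) = psi C -> i = j.
  move=> lt_i lt_j eqC; apply: sP => //.
  have := psiD A B C; rewrite -eqC.
  have -> //: s i + psi A + (psi B - s j) - psi A - psi B = s i - s j.
  by rewrite [psi B - _]addrC addrACA -(addrA _ (- psi A)) -opprD addrK.
move=> C; apply/exists_inP/existsP => [[a1 a1P /exists_inP[a2 a2P /eqP eqC]] | [i iY]].
  (* Each summand is genuine or padding. Padding always combines two different translates, which
     [clash] excludes. *)
  case: (fillP a1P) => /imsetP[]; case: (fillP a2P) => /imsetP[].
  - move=> [j B] /= BY ea2 [i A]; rewrite inE /= => sA ea1.
    have eq_ij : i = j.
      by apply: enum_rank_inj; apply: val_inj; apply: (@clash A B C _ _ (sg_lt i) (sg_lt j));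
        rewrite -eqC ea1 ea2.
    subst j; exists i.
    have dW := disjY _ BY; rewrite /= in dW.
    have dAB : [disjoint A & B] by apply: disjointWl sA dW.
    have -> : C = A :|: B.
      by apply: psi_inj; rewrite psiU // -eqC ea1 ea2 [sg i + _]addrC addrACA subrr addr0.
    rewrite setDUl (_ : A :\: W i = set0) ?set0U; last by apply/eqP; rewrite setD_eq0.
    by rewrite setDE (setIidPl _) // -disjoints_subset disjoint_sym.
  - move=> A _ ea2 [i B] _ ea1; have := @clash B A C (enum_rank i) #|I|.+1 (sg_lt i).
    rewrite -eqC ea1 ea2 => /(_ ltac:(lia) erefl) eq_i.
    by have := ltn_ord (enum_rank i); rewrite eq_i ltnNge leqnSn.
  - move=> [j B] _ ea2 A _ ea1; have := @clash A B C #|I| (enum_rank j) _ (sg_lt j).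
    rewrite -eqC ea1 ea2 => /(_ ltac:(lia) erefl) eq_j.
    by have := ltn_ord (enum_rank j); rewrite -eq_j ltnn.
  - move=> B _ ea2 A _ ea1; have := @clash A B C #|I| #|I|.+1.
    by rewrite -eqC ea1 ea2 => /(_ ltac:(lia) ltac:(lia) erefl) /n_Sn.
have dW := disjY _ iY.
exists (sg i + psi (C :&: W i)).
  rewrite inE; apply/orP; left; apply/imsetP; exists (i, C :&: W i) => //.
  by rewrite inE subsetIr.
apply/exists_inP; exists (psi (C :\: W i) - sg i).
  by rewrite inE; apply/orP; left; apply/imsetP; exists (i, C :\: W i).
rewrite [sg i + _]addrC addrACA subrr addr0 -psiU ?setID //.
by rewrite disjoint_sym disjoints_subset setDE (subset_trans (subsetIr _ _)) // setCS subsetIr.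
Qed.

(** * From the butterfly to 3SUM-Indexing *)

Local Open Scope nat_scope.

Lemma probes_leq_query_time n S w (G : finZmodType) (D : cell_probe_ds S w G)
    (A1 A2 : {set G}) z :
  #|A1| = n -> #|A2| = n ->
  probes (query D z) (preprocess D A1 A2) <= query_time n D.
Proof.
move=> cardA1 cardA2; rewrite /query_time.
pose F (A : {set G} * {set G}) := \max_y probes (query D y) (preprocess D A.1 A.2).
apply: (@leq_trans (F (A1, A2))).
  exact: (leq_bigmax (F := fun y => probes (query D y) (preprocess D A1 A2))).
by apply: (leq_bigmax_cond (F := F)); rewrite /= cardA1 cardA2 !eqxx.
Qed.

(** Factor by factor, [N - i >= R (n - i)]. *)
Lemma expn_leq_bin R n N : 0 < R -> R * n <= N -> R ^ n <= 'C(N, n).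
Proof.
move=> R_gt0 le_N; rewrite -(leq_pmul2r (fact_gt0 n)) bin_ffact ffact_prod.
have -> : n`! = \prod_(i < n) (n - i).
  by rewrite -ffactnn ffact_prod.
rewrite -[n in _ ^ n]card_ord -prod_nat_const -big_split /=.
by apply: leq_prod => i _; have := ltn_ord i; nia.
Qed.

Section Coordinates.
Context {d b e : nat}.

Definition coord : finType := ('I_d * 'I_b + 'I_d * 'I_b + 'I_e)%type.

(** These are the coordinates on which the [i]-th edge of a path does not depend; removing them from
    the ends leaves the edge. *)
Definition past (i : 'I_d) : {set coord} :=
  [set j : coord | match j with
           | inl (inl (k, _)) => k < i
           | inl (inr (k, _)) => i < k
           | inr _ => false
           end].

Definition cube_of_ends (v : ends d {set 'I_b} {set 'I_e}) : {set coord} :=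
  [set j : coord | match j with
           | inl (inl (k, l)) => l \in v.1.1 k
           | inl (inr (k, l)) => l \in v.1.2 k
           | inr l => l \in v.2
           end].

Definition cube_of_arc (a : arc d {set 'I_b} {set 'I_e}) : {set coord} :=
  let: (i, u, x) := a in
  [set j : coord | match j with
           | inl (inl (k, l)) => (i <= k) && (l \in u.1 k)
           | inl (inr (k, l)) => if k < i then l \in u.1 k else (k == i) && (l \in x)
           | inr l => l \in u.2
           end].

Lemma cube_of_ends_past v i : cube_of_ends v :\: past i = cube_of_arc (edge i v).
Proof.
apply/setP => -[[[k l]|[k l]]|l]; rewrite !inE //= ?ffunE.
  by rewrite -leqNgt; case: leqP => //; rewrite ltnNge => ->.
by rewrite -leqNgt -val_eqE /=; case: ltngtP => // /val_inj ->.
Qed.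

Lemma past_cube_of_arc a : [disjoint past a.1.1 & cube_of_arc a].
Proof.
case: a => [[i u] x]; rewrite disjoints_subset; apply/subsetP => -[[[k l]|[k l]]|l].
- by rewrite !inE ltnNge => /negbTE ->.
- by rewrite !inE -val_eqE /= => lt_ik; rewrite ltnNge ltnW // gtn_eqF.
- by rewrite inE.
Qed.

Lemma cube_of_arc_inj : injective (fun a => (a.1.1, cube_of_arc a)).
Proof.
move=> [[i [u f]] x] [[i' [u' f']] x'] /= [<-] /setP eqj.
congr (_, (_, _), _).
- apply/ffunP => k; apply/setP => l; case: (leqP i k) => [le_ik|lt_ki].
    by have := eqj (inl (inl (k, l))); rewrite !inE le_ik.
  by have := eqj (inl (inr (k, l))); rewrite !inE lt_ki.
- by apply/setP => l; have := eqj (inr l); rewrite !inE.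
- by apply/setP => l; have := eqj (inl (inr (i, l))); rewrite !inE ltnn eqxx.
Qed.

(** At each level [k] at most one of the source and target digits belongs to [past i], so one block
    of [b] bits per level records the subset. *)
Lemma card_past_subsets :
  #|[set p : 'I_d * {set coord} | p.2 \subset past p.1]| <= d * 2 ^ (b * d).
Proof.
pose f (p : 'I_d * {set coord}) := (p.1, [set kl : 'I_d * 'I_b |
  if kl.1 < p.1 then inl (inl kl) \in p.2 else inl (inr kl) \in p.2]).
have f_inj : {in [set p : 'I_d * {set coord} | p.2 \subset past p.1] &, injective f}.
  move=> [i A] [i' A']; rewrite !inE /= => sA sA' [eq_i /setP eqA]; subst i'.
  congr (_, _); apply/setP => -[[[k l]|[k l]]|l].
  - case: (ltnP k i) => [lt_ki|le_ik]; first by have := eqA (k, l); rewrite !inE /= lt_ki.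
    have outA : (inl (inl (k, l)) \in A) = false.
      by apply: contraTF le_ik => /(subsetP sA); rewrite inE -ltnNge.
    by rewrite outA; apply/esym; apply: contraTF le_ik => /(subsetP sA'); rewrite inE -ltnNge.
  - case: (ltnP k i) => [lt_ki|le_ik]; last by have := eqA (k, l); rewrite !inE /= ltnNge le_ik.
    have outA : (inl (inr (k, l)) \in A) = false.
      by apply: contraTF (ltnW lt_ki) => /(subsetP sA); rewrite inE -ltnNge.
    rewrite outA; apply/esym; apply: contraTF (ltnW lt_ki) => /(subsetP sA').
    by rewrite inE -ltnNge.
  - have outA : (inr l \in A) = false by apply/negP => /(subsetP sA); rewrite inE.
    by rewrite outA; apply/esym/negP => /(subsetP sA'); rewrite inE.
rewrite -(card_in_imset f_inj); apply: leq_trans (max_card _) _.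
by rewrite card_prod card_set_of card_prod !card_ord [b * d]mulnC.
Qed.

End Coordinates.
Arguments coord : clear implicits.

Lemma card_coord d b e : #|coord d b e| = 2 * (b * d) + e.
Proof. by rewrite !card_sum !card_prod !card_ord; lia. Qed.

(** The gadget is used with [W = past]. The bounds on [n] leave room for all arcs in [A2] and for
    the padding taken from the cube. *)
Lemma indexing_butterfly n S w (G : finZmodType) (D : cell_probe_ds S w G) d k e r :
  solves_3sum_indexing n D -> cube_embeds G (coord d (8 * k) e) ->
  d * 2 ^ (8 * k * d + e + 8 * k) <= n <= 2 ^ (2 * (8 * k * d) + e) ->
  8 * (d + 2) * 2 ^ (2 * (8 * k * d) + e) < #|G| ->
  6 < k -> 0 < d -> 0 < query_time n D ->
  w <= 2 ^ k -> r <= 16 * k -> S <= 2 ^ r * 2 ^ (8 * k * d + e) ->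
  d <= 18 * query_time n D.
Proof.
move=> solD embG /andP[le_arcs le_n] lt_G k_gt6 d_gt0 qt_gt0 le_w le_r le_S.
pose X : finType := {set 'I_(8 * k)}; pose E : finType := {set 'I_e}.
have cardX : #|X| = 2 ^ (8 * k) by rewrite card_set_of card_ord.
have cardE : #|E| = 2 ^ e by rewrite card_set_of card_ord.
have card_state : #|{: state d X E}| = 2 ^ (8 * k * d + e).
  by rewrite card_prod card_ffun cardX cardE card_ord -expnM -expnD.
have card_arc : #|{: arc d X E}| <= n.
  by rewrite !card_prod card_ord -card_prod card_state cardX -mulnA -expnD.
have le_past := @card_past_subsets d (8 * k) e.
have [| |q [A1 [A2 [cardA1 A2P]]]] := @sumset_gadget G 'I_d _ (@past d (8 * k) e) n embG.
- rewrite card_coord le_n andbT (leq_trans le_past) // (leq_trans _ le_arcs) //.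
  by rewrite leq_mul2l leq_exp2l // -addnA leq_addr orbT.
- by rewrite card_coord card_ord.
pose code (a : arc d X E) := (a.1.1, cube_of_arc a).
pose A2c (Y : {set arc d X E}) := A2 [set code a | a in Y].
have A2cP Y : #|A2c Y| = n /\ forall v,
    in_sumset A1 (A2c Y) (q (cube_of_ends v)) = [exists i, edge i v \in Y].
  have [||cardA2 inA2] := A2P [set code a | a in Y].
  - by rewrite (leq_trans (leq_imset_card _ _)) // (leq_trans (max_card _)).
  - by move=> _ /imsetP[a _ ->]; apply: past_cube_of_arc.
  split=> // v; rewrite inA2; apply: eq_existsb => i.
  by rewrite cube_of_ends_past -[(i, _)]/(code (edge i v)) mem_imset //; apply: cube_of_arc_inj.
apply: (@butterfly_bound S w _ d k r X E (fun v => query D (q (cube_of_ends v)))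
  (fun Y => preprocess D A1 (A2c Y))) => //.
- by rewrite cardE expn_gt0.
- by rewrite card_state.
- by move=> Y v; have [cardA2 inA2] := A2cP Y; rewrite solD // inA2.
- by move=> Y v; have [cardA2 inA2] := A2cP Y; apply: probes_leq_query_time.
Qed.

Lemma run_probes0 S w (t : probe_tree S w) M M' : probes t M = 0 -> run t M = run t M'.
Proof. by case: t. Qed.

(** With a single level and [W] empty, the queries decide membership in an arbitrary [n]-subset [Y]
    of the cube. The memory thus determines [Y], and without probes the answers could not tell two
    sets [Y] apart. *)
Lemma indexing_entropy n S w (G : finZmodType) (D : cell_probe_ds S w G) (J : finType) P :
  solves_3sum_indexing n D -> cube_embeds G J -> 0 < n -> 0 < P ->
  n * 2 ^ P <= 2 ^ #|J| -> 24 * 2 ^ #|J| < #|G| ->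
  n * P <= S * w /\ 0 < query_time n D.
Proof.
move=> solD embG n_gt0 P_gt0 le_nP lt_G.
have le_nJ : n <= 2 ^ #|J| by rewrite (leq_trans _ le_nP) // leq_pmulr // expn_gt0.
have [| |q [A1 [A2 [cardA1 A2P]]]] := @sumset_gadget G unit J (fun=> set0) n embG.
- rewrite le_nJ andbT (leq_trans _ n_gt0) // -(cards1 (tt, set0 : {set J})).
  apply/subset_leq_card/subsetP => -[[] A]; rewrite !inE subset0 => /eqP /= ->.
  by rewrite eqxx.
- by rewrite card_unit.
pose A2c (Y : {set {set J}}) := A2 [set (tt, A) | A in Y].
have A2cP (Y : {set {set J}}) : #|Y| = n ->
    #|A2c Y| = n /\ forall C, in_sumset A1 (A2c Y) (q C) = (C \in Y).
  move=> cardY; have [||cardA2 inA2] := A2P [set (tt, A) | A in Y].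
  - by rewrite (leq_trans (leq_imset_card _ _)) // cardY.
  - by move=> p _; rewrite disjoints_subset sub0set.
  split=> // C; rewrite inA2; apply/existsP/idP => [[[]]|CY]; last exists tt;
    by rewrite setD0 mem_imset // => A B [].
pose sets_n := [set Y : {set {set J}} | #|Y| == n].
have card_sets : (2 ^ P) ^ n <= #|sets_n|.
  by rewrite card_draws card_set_of expn_leq_bin ?expn_gt0 // mulnC.
pose mem Y := preprocess D A1 (A2c Y).
have mem_inj Y Y' : Y \in sets_n -> Y' \in sets_n ->
    (forall C, run (query D (q C)) (mem Y) = run (query D (q C)) (mem Y')) -> Y = Y'.
  rewrite !inE => /eqP cY /eqP cY' eqrun; apply/setP => C.
  have [c1 <-] := A2cP Y cY; have [c2 <-] := A2cP Y' cY'.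
  by rewrite -!solD.
split.
  have card_mem : #|sets_n| <= 2 ^ (S * w).
    have inj : {in sets_n &, injective mem}.
      by move=> Y Y' YS Y'S eqm; apply: mem_inj => // C; rewrite eqm.
    rewrite -(card_in_imset inj) (leq_trans (max_card _)) //.
    by rewrite card_tuple card_tuple card_bool -expnM mulnC.
  by have := leq_trans card_sets card_mem; rewrite -expnM leq_exp2l // mulnC.
rewrite lt0n; apply/negP => /eqP qt0.
have : #|sets_n| <= 1.
  apply/card_le1_eqP => Y Y' YS Y'S; apply: mem_inj => // C; apply: run_probes0.
  apply/eqP; rewrite -leqn0 -qt0; apply: probes_leq_query_time => //.
  by move: Y'S; rewrite inE => /eqP /A2cP[].
rewrite leqNgt => /negP; apply; apply: leq_trans card_sets.
by rewrite -expnM -[1]/(2 ^ 0) ltn_exp2l // muln_gt0 P_gt0.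
Qed.

(** The butterfly gets depth [d], about [P / (8k)], with [k] proportional to [b]. From [d <= 18 T]
    and [P < (d + 1) 8k <= 16 k d] comes the constant [288 = 16 * 18]. *)
Lemma query_time_lower n S w (G : finZmodType) (D : cell_probe_ds S w G) q K
    (P := trunc_log 2 n %/ q) (b := (trunc_log 2 (S * w %/ n)).+1) :
  solves_3sum_indexing n D ->
  (forall J : finType, 2 ^ #|J| <= #|G| -> cube_embeds G J) ->
  2 < q -> 0 < n -> 64 + 2 * q <= P -> n * 2 ^ (3 * P) <= #|G| ->
  w <= ((trunc_log 2 n).+1 + 2 ^ b) ^ K ->
  [/\ 1 < b, n * 2 ^ b.-1 <= S * w & P <= 288 * (2 * K + 1) * b * query_time n D].
Proof.
move=> solD embG q_gt2 n_gt0 le_P le_G le_w.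
set T := query_time n D; set L := trunc_log 2 n in P le_P le_G le_w *.
have le_qP : q * P <= L by rewrite mulnC leq_trunc_div.
have lt_L : L < P.+1 * q by rewrite ltn_ceil // (ltn_trans _ q_gt2).
have le_Ln : 2 ^ L <= n by apply: trunc_logP.
have lt_nL : n < 2 ^ L.+1 by apply: trunc_log_ltn.
have P_lt2 : P < 2 ^ P by apply: ltn_expl.
have e3P : 2 ^ (3 * P) = 2 ^ P * 2 ^ P * 2 ^ P by rewrite -!expnD; congr (2 ^ _); lia.
have key : 48 * (2 ^ L * 2 ^ P) < n * 2 ^ (3 * P).
  rewrite e3P; apply: (@leq_trans ((2 ^ P * 2 ^ P) * (2 ^ L * 2 ^ P))).
    by rewrite ltn_mul2r muln_gt0 !expn_gt0 /=; nia.
  by rewrite mulnA [_ * 2 ^ L]mulnC -!mulnA leq_mul2r le_Ln orbT.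
have [le_info T_gt0] : n * P <= S * w /\ 0 < T.
  apply: (@indexing_entropy n S w G D 'I_(L.+1 + P) P) => //; rewrite ?card_ord.
  - apply: embG; rewrite card_ord; apply: leq_trans le_G; rewrite expnD expnS; lia.
  - by lia.
  - by rewrite expnD leq_mul2r (ltnW lt_nL) orbT.
  - apply: leq_trans le_G; rewrite expnD expnS; lia.
have le_PSw : P <= S * w %/ n by rewrite leq_divRL // mulnC.
have SwG0 : 0 < S * w %/ n by lia.
have lt_Swb : S * w %/ n < 2 ^ b by apply: trunc_log_ltn.
have le_bSw : 2 ^ b.-1 <= S * w %/ n by apply: trunc_logP.
have lt_Sw : S * w < n * 2 ^ b by rewrite [n * _]mulnC -ltn_divLR.
have lt_Pb : P < 2 ^ b by lia.
(* [P >= 64] makes [b], hence [k], large enough for [butterfly_bound]. *)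
have b_gt6 : 6 < b.
  by rewrite -(ltn_exp2l 6 b (isT : 1 < 2)) (leq_ltn_trans _ lt_Pb) //; lia.
split; [by lia | by rewrite [n * _]mulnC -leq_divRL |].
have eqT : query_time n D = T by [].
clearbody P b T L.
pose k := (2 * K + 1) * b; have k_ge : b <= k by rewrite /k; nia.
suff: P <= 288 * k * T by rewrite /k mulnA.
have k_gt0 : 0 < k by rewrite (leq_trans _ k_ge) // (leq_ltn_trans _ b_gt6).
have k8_gt0 : 0 < 8 * k by rewrite muln_gt0.
have [d lt_P le_bdP] : exists2 d, P < d.+1 * (8 * k) & 8 * k * d <= P.
  by exists (P %/ (8 * k)); [rewrite ltn_ceil | rewrite mulnC leq_trunc_div].
have [le_d1|d_gt1] := leqP d 1; first by nia.
suff: d <= 18 * T by nia.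
have d_gt0 : 0 < d by lia.
have den_gt0 : 0 < d * 2 ^ (8 * k) by rewrite muln_gt0 d_gt0 expn_gt0.
have le_dP : d <= P by nia.
have le_den : 2 ^ (8 * k * d) * (d * 2 ^ (8 * k)) <= n.
  apply: (@leq_trans (2 ^ (3 * P))); last first.
    by rewrite (leq_trans _ le_Ln) // leq_exp2l //; nia.
  rewrite e3P -(mulnA (2 ^ P)); apply: leq_mul; first by rewrite leq_exp2l.
  apply: leq_mul; first exact: leq_trans le_dP (ltnW _).
  by rewrite leq_exp2l //; nia.
(* [p] is the largest exponent for which the [d * 2 ^ (p + 8 * k)] arcs number at most [n]; what
   exceeds [8 * k * d] becomes the exponent [e] of the number of copies. *)
have [p [le_bdp le_pn lt_np]] : exists p, [/\ 8 * k * d <= p,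
    d * 2 ^ (p + 8 * k) <= n & n < 2 ^ p.+1 * (d * 2 ^ (8 * k))].
  rewrite -leq_divRL // in le_den; exists (trunc_log 2 (n %/ (d * 2 ^ (8 * k)))); split.
  - by rewrite trunc_log_max.
  - rewrite expnD mulnCA -leq_divRL // trunc_logP // (leq_trans _ le_den) // expn_gt0.
    by [].
  - by rewrite -ltn_divLR // trunc_log_ltn.
have d_lt2 : d < 2 ^ d by apply: ltn_expl.
have le_np : n <= 2 ^ (8 * k * d + p).
  apply: leq_trans (ltnW lt_np) _; apply: (@leq_trans (2 ^ (p.+1 + (d + 8 * k)))).
    by rewrite !expnD leq_mul2l leq_mul2r (ltnW d_lt2) !orbT.
  have le_kd y : 3 < y -> d.+1 + y <= y * d by move=> y_gt3; clear - y_gt3 d_gt1; nia.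
  by rewrite leq_exp2l // addSnnS -addSn addnC leq_add2r le_kd //; lia.
pose e := p - 8 * k * d.
have eqp : 8 * k * d + e = p by rewrite subnKC.
have eqp2 : 2 * (8 * k * d) + e = 8 * k * d + p by rewrite mul2n -addnn -addnA eqp.
have lt_G : 8 * (d + 2) * 2 ^ (8 * k * d + p) < #|G|.
  apply: leq_trans le_G; rewrite expnD.
  apply: (@leq_trans (2 ^ (8 * k * d) * (d * 2 ^ (p + 8 * k)))).
    rewrite mulnCA ltn_pmul2l ?expn_gt0 // expnD mulnCA mulnC ltn_pmul2l ?expn_gt0 //.
    have : 2 ^ 5 <= 2 ^ (8 * k) by rewrite leq_exp2l //; lia.
    by clear - d_gt1; move: (2 ^ (8 * k)) => B; nia.
  by rewrite mulnC leq_mul // leq_exp2l //; lia.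
rewrite -eqT; apply: (@indexing_butterfly n S w G D d k e (16 * k)) => //.
- apply: embG; rewrite card_coord eqp2; apply: leq_trans (ltnW lt_G).
  by rewrite leq_pmull //; lia.
- by rewrite eqp eqp2 le_pn.
- by rewrite eqp2.
- by lia.
- by rewrite eqT.
(* Here [L + 1 <= (P + 1) q <= 2 ^ b * q] and [q + 1 <= 2 ^ b], so the base is at most [2 ^ (2b)];
   this is why [k] contains the factor [2K + 1]. *)
- apply: leq_trans le_w _; apply: (@leq_trans ((2 ^ (2 * b)) ^ K)).
    have [->|K_gt0] := posnP K; first by rewrite !expn0.
    rewrite leq_exp2r // mul2n -addnn expnD.
    apply: (@leq_trans (2 ^ b * q.+1)); last by rewrite leq_mul2l; apply/orP; right; lia.
    by rewrite mulnS addnC leq_add2l (leq_trans lt_L) // leq_mul2r lt_Pb orbT.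
  by rewrite -expnM leq_exp2l // /k -mulnA mulnCA; lia.
rewrite eqp; have w_gt0 : 0 < w.
  have : 0 < S * w by apply: leq_trans le_info; rewrite muln_gt0 n_gt0; lia.
  by rewrite muln_gt0 => /andP[].
apply: (@leq_trans (S * w)); first by rewrite leq_pmulr.
(* [S] exceeds [2 ^ p] by at most a factor [2 ^ (8k + 2b + 1)], which [r = 16k] covers. *)
apply: leq_trans (ltnW lt_Sw) _; apply: (@leq_trans (2 ^ (p.+1 + (b + 8 * k) + b))).
  rewrite (expnD _ _ b) leq_mul2r; apply/orP; right; apply: leq_trans (ltnW lt_np) _.
  rewrite (expnD _ p.+1) (expnD _ b); apply: leq_mul => //; apply: leq_mul => //; lia.
by rewrite -expnD leq_exp2l //; lia.
Qed.

(** * Passage to real logarithms *)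

Local Open Scope ring_scope.

Lemma log2X (R : realType) k : log2 (2 ^+ k : R) = k%:R.
Proof. by rewrite /log2 lnXn // -[ln _ *+ _]mulr_natl mulfK // gt_eqF // ln_gt0 // ltr1n. Qed.

Lemma ler_log2 (R : realType) (x y : R) : 0 < x -> 0 < y -> (log2 x <= log2 y) = (x <= y).
Proof. by move=> x_gt0 y_gt0; rewrite /log2 ler_pM2r ?invr_gt0 ?ln_gt0 ?ltr1n // ler_ln. Qed.

Lemma log2M (R : realType) (x y : R) : 0 < x -> 0 < y -> log2 (x * y) = log2 x + log2 y.
Proof. by move=> x_gt0 y_gt0; rewrite /log2 lnM // mulrDl. Qed.

Lemma trunc_log_log2 (R : realType) n : (0 < n)%N ->
  (trunc_log 2 n)%:R <= log2 (n%:R : R) <= (trunc_log 2 n).+1%:R.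
Proof.
move=> n_gt0; rewrite -(log2X R (trunc_log 2 n)) -(log2X R (trunc_log 2 n).+1) -2!natrX.
rewrite !ler_log2 ?ltr0n ?expn_gt0 // !ler_nat trunc_logP //=.
by rewrite ltnW // trunc_log_ltn.
Qed.

(** [1152 = 4 * 288]: the estimates [P + 1 <= 2P] and [b <= 2(b - 1)] cost a factor 2 each. *)
Lemma log_leq_probes L P q A b T :
  (L < P.+1 * q -> 0 < P -> P <= 288 * A * b * T -> 1 < b ->
   L.+1 <= 1152 * q * A * T * b.-1)%N.
Proof.
move=> lt_L P_gt0 le_P b_gt1; apply: (@leq_trans (2 * q * P)).
  by apply: leq_trans lt_L _; rewrite -mulnA mulnCA [leqLHS]mulnC leq_mul2l; lia.
apply: (@leq_trans (2 * q * (288 * A * b * T))); first by rewrite leq_mul2l le_P orbT.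
have -> : (2 * q * (288 * A * b * T) = 576 * q * A * T * b)%N by lia.
have -> : (1152 * q * A * T * b.-1 = 576 * q * A * T * (2 * b.-1))%N by lia.
by rewrite leq_mul2l; lia.
Qed.

Lemma indexing_lower_bound_of_cubes (R : realType) (delta B cw : R) (K : nat) :
  0 < delta ->
  exists2 c : R, 0 < c &
  exists n0 : nat, forall (n : nat) (G : finZmodType), (n0 <= n)%N ->
    (forall J : finType, (2 ^ #|J| <= #|G|)%N -> cube_embeds G J) ->
    (1 + delta) * log2 (n%:R : R) - B <= log2 #|G|%:R ->
    indexing_lower_bound c cw K n G.
Proof.
move=> delta_gt0.
(* With [4 <= delta * q], the surplus [delta * log2 n] is at least [4P]; one [P] absorbs [B], and
   [3P] remain for [query_time_lower]. *)
have [q [q_gt2 le_q]] : exists q, (2 < q)%N /\ 4 <= delta * q%:R.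
  exists (Num.truncn (4 / delta)).+3; split => //.
  rewrite mulrC -ler_pdivrMr // (le_trans (ltW (truncnS_gt _))) // ler_nat.
  by do 2!apply: leqW.
have [P0 le_P0 le_BP0] : exists2 P0, (64 + 2 * q <= P0)%N & B <= P0%:R.
  exists (64 + 2 * q + (Num.truncn B).+1)%N; first exact: leq_addr.
  by rewrite natrD (le_trans (ltW (truncnS_gt _))) // lerDr.
have q_gt0 : (0 < q)%N by lia.
pose c : R := (1152 * q * (2 * K + 1))%N%:R^-1.
exists c; first by rewrite invr_gt0 ltr0n !muln_gt0 q_gt0 addn1.
exists (2 ^ (q * P0))%N => n G le_n embG le_G S w D solD _ le_w.
have n_gt0 : (0 < n)%N by rewrite (leq_trans _ le_n) // expn_gt0.
have /andP[le_L lt_L] := trunc_log_log2 R n_gt0.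
set L := trunc_log 2 n in le_L lt_L; set P := (L %/ q)%N.
have le_P : (P0 <= P)%N by rewrite leq_divRL // mulnC trunc_log_max.
have le_qP : (q * P <= L)%N by rewrite mulnC leq_trunc_div.
have P_gt0 : (0 < P)%N by rewrite (leq_trans _ le_P) // (leq_trans _ le_P0).
have G_gt0 : (0 < #|G|)%N by apply/card_gt0P; exists 0.
have le_nG : (n * 2 ^ (3 * P) <= #|G|)%N.
  rewrite -(ler_nat R) natrM natrX -ler_log2 ?mulr_gt0 ?exprn_gt0 ?ltr0n //.
  rewrite log2M ?exprn_gt0 ?ltr0n // log2X natrM (le_trans _ le_G) //.
  have hP : B <= P%:R by rewrite (le_trans le_BP0) // ler_nat.
  have hqP : q%:R * P%:R <= log2 (n%:R : R) by rewrite -natrM (le_trans _ le_L) // ler_nat.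
  have hd : delta * (q%:R * P%:R) <= delta * log2 (n%:R : R) by rewrite ler_pM2l.
  have h4 : 4 * P%:R <= delta * q%:R * P%:R by rewrite ler_wpM2r.
  by rewrite mulrA in hd; lra.
have n0R : 0 < n%:R :> R by rewrite ltr0n.
set b := (trunc_log 2 (S * w %/ n)).+1.
have [b_gt1 le_bSw le_PT] : [/\ (1 < b)%N, (n * 2 ^ b.-1 <= S * w)%N &
    (P <= 288 * (2 * K + 1) * b * query_time n D)%N].
  apply: query_time_lower => //; first exact: leq_trans le_P.
  rewrite -(ler_nat R) natrX (le_trans le_w) // lerXn2r ?nnegrE //.
  - by rewrite addr_ge0 ?(le_trans _ le_L) // mulr_ge0 ?invr_ge0 ?mulr_ge0.
  - rewrite natrD lerD // ler_pdivrMr // -!natrM ler_nat.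
    apply: leq_trans (ltnW (ltn_ceil _ n_gt0)) _.
    by rewrite leq_mul2r trunc_log_ltn ?orbT.
have Sw_gt0 : (0 < S * w)%N by rewrite (leq_trans _ le_bSw) // muln_gt0 n_gt0 expn_gt0.
(* This bounds the denominator below by [b - 1], which is positive. *)
have le_b : (b.-1)%:R <= log2 (S%:R * w%:R / n%:R : R).
  rewrite -log2X -natrM ler_log2 ?exprn_gt0 ?divr_gt0 ?ltr0n // ler_pdivlMr ?ltr0n //.
  by rewrite -natrX -natrM ler_nat mulnC.
have b1_gt0 : 0 < (b.-1)%:R :> R by rewrite ltr0n; exact: b_gt1.
have le_LT : (L.+1 <= 1152 * q * (2 * K + 1) * query_time n D * b.-1)%N.
  by apply: (log_leq_probes _ P_gt0 le_PT b_gt1); rewrite ltn_ceil.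
rewrite ler_pdivrMl; last by rewrite ltr0n !muln_gt0 q_gt0 addn1.
rewrite ler_pdivrMr ?(lt_le_trans b1_gt0) //.
apply: le_trans lt_L _.
apply: (@le_trans _ _ ((1152 * q * (2 * K + 1))%:R * (query_time n D)%:R * (b.-1)%:R)).
  by rewrite -!natrM ler_nat.
by rewrite ler_wpM2l // mulr_ge0.
Qed.

(* [bool] carries XOR as its addition, so ['rV[bool]_k] is {0,1}^k with bitwise
   XOR. *)
Theorem theorem3 (R : realType) (delta C cw : R) (K : nat)
    (hdelta : 0 < delta) (hC : 0 < C) (hcw : 0 < cw) :
  exists2 c : R, 0 < c &
  exists n0 : nat, forall n : nat, (n0 <= n)%N ->
    (forall m : nat, (1 < m)%N ->
       C^-1 * n%:R `^ (1 + delta) <= m%:R <= C * n%:R `^ (1 + delta) ->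
       indexing_lower_bound c cw K n 'Z_m) /\
    (forall k : nat,
       `|k%:R - (1 + delta) * log2 (n%:R : R)| <= C ->
       indexing_lower_bound c cw K n 'rV[bool]_k).
Proof.
(* The logarithm of the group order may fall short by [log2 C] in the cyclic case and by [C] in the
   XOR case. *)
have [c c_gt0 [n0 bound]] :=
  indexing_lower_bound_of_cubes (Num.max C (log2 C)) cw K hdelta.
exists c => //; exists (maxn 1 n0) => n; rewrite geq_max => /andP[n_gt0 le_n0].
have n0R : 0 < n%:R :> R by rewrite ltr0n.
split=> [m m_gt1 /andP[le_m _]|k le_k]; apply: bound => //.
- by move=> J le_J; apply: cube_embeds_Zp => //; rewrite card_ord Zp_cast in le_J.
- rewrite card_ord Zp_cast //; apply: (@le_trans _ _ (log2 (C^-1 * n%:R `^ (1 + delta)))).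
  + rewrite log2M ?invr_gt0 ?powR_gt0 // addrC /log2 lnV ?posrE // ln_powR mulNr -mulrA.
    by rewrite lerD2r lerN2 le_max lexx orbT.
  + by rewrite ler_log2 ?mulr_gt0 ?invr_gt0 ?powR_gt0 // ltr0n ltnW.
- move=> J le_J; apply: cube_embeds_bool.
  by move: le_J; rewrite card_mx card_bool mul1n leq_exp2l.
- rewrite card_mx card_bool mul1n natrX log2X.
  move: le_k; rewrite ler_norml => /andP[le_k _].
  have : C <= Num.max C (log2 C) by rewrite le_max lexx.
  by move: le_k; lra.
Qed.
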